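(* Let $f(X,Y,Z)=\sum_{\underline{i}=(i_1,i_2,i_3)\in\{0,1,2\}^3}p_{\underline{i}}X^{i_1}Y^{i_2}Z^{i_3}$ with all $p_{\underline{i}}\in\mathbb{Q}$, and let $x,y,z$ be complex roots of unity with $f(x,y,z)=0$. Fix a decomposition $\{0,1,2\}^3=\coprod_{j=1}^r I_j$ into nonempty sets such that, for each $j$, $\sum_{\underline{i}\in I_j}p_{\underline{i}}x^{i_1}y^{i_2}z^{i_3}=0$, while $\sum_{\underline{i}\in I}p_{\underline{i}}x^{i_1}y^{i_2}z^{i_3}\neq 0$ for every proper nonempty subset $I\subsetneq I_j$. For each $j$ choose $\underline{i}_j\in I_j$ and let $M_j=\langle \underline{i}-\underline{i}_j \mid \underline{i}\in I_j\rangle_{\mathbb{Z}}\subseteq\mathbb{Z}^3$ (this does not depend on the choice of $\underline{i}_j$). Let $M=M_1+\cdots+M_r$. Then: (1) If the quotient $\mathbb{Z}^3/M$ is infinite, there exist $\alpha_1,\alpha_2,\alpha_3\in\mathbb{Z}$, not all equal to zero, such that $f(xt^{\alpha_1},yt^{\alpha_2},zt^{\alpha_3})=0$ for all $t\in\mathbb{C}^\times$. (2) If the quotient $\mathbb{Z}^3/M$ is finite, let $e$ denote its exponent and let $\ell=\max\{|I_j| : j=1,\ldots,r\}$. Then the common order of $x,y,z$ divides $en$, where $n=\prod_{p\text{ prime},\,p\le\ell}p$.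
   Context: The common order of roots of unity $x,y,z$ is the least common multiple of their multiplicative orders. The exponent of a finite abelian group is the least positive integer annihilating it. *)

(* Defs.v *)
From HB Require Import structures.
From mathcomp Require Import all_boot all_order all_algebra.
From mathcomp Require Import ring_quotient.
From mathcomp Require Import boolp classical_sets cardinality reals.
From mathcomp Require Export complex.
Set Implicit Arguments.
Unset Strict Implicit.
Unset Printing Implicit Defensive.
Import GRing.Theory.
Local Open Scope ring_scope.

(* {0,1,2}^3; the coordinates (i_1, i_2, i_3) of i are i 0, i 1, i 2. *)
Notation multiindex := {ffun 'I_3 -> 'I_3}.

Definition to_Z3 (i : multiindex) : 'rV[int]_3 := \row_k (i k : nat)%:Z.

Definition partial_sum (F : fieldType) (p : multiindex -> rat) (x y z : F)
    (J : {set multiindex}) : F :=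
  \sum_(i in J) ratr (p i) * x ^+ i 0 * y ^+ i 1 * z ^+ i 2%:R.

Definition feval (F : fieldType) (p : multiindex -> rat) (x y z : F) : F :=
  partial_sum p x y z [set: multiindex].

Definition minimal_vanishing (F : fieldType) (p : multiindex -> rat)
    (x y z : F) (I : {set multiindex}) : Prop :=
  partial_sum p x y z I = 0 /\
  forall J : {set multiindex},
    J != finset.set0 -> J \proper I -> partial_sum p x y z J != 0.

(* [0 < n] is needed: every element satisfies [0.-unity_root]. *)
Definition is_root_of_unity (F : fieldType) (x : F) : Prop :=
  exists2 n : nat, (0 < n)%N & n.-unity_root x.

Definition is_common_order (F : fieldType) (x y z : F) (m : nat) : Prop :=
  exists a b c : nat,
    [/\ a.-primitive_root x, b.-primitive_root y, c.-primitive_root z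
      & m = lcmn (lcmn a b) c].

Definition is_exponent (V : zmodType) (e : nat) : Prop :=
  [/\ (0 < e)%N, forall v : V, v *+ e = 0
    & forall d : nat, (0 < d)%N -> (forall v : V, v *+ d = 0) -> (e <= d)%N].

(* The membership predicate of M_j, for I = I_j and i0 = i_j. *)
Definition in_block_lattice (I : {set multiindex}) (i0 : multiindex)
    (v : 'rV[int]_3) : Prop :=
  inIntSpan [tuple of [seq to_Z3 i - to_Z3 i0 | i in I]] v.

(* M is the sum of the M_j; the blocks I_j are the elements of P, and b picks
   the base point i_j of each of them. *)
Definition lattice_sum (P : {set {set multiindex}})
    (b : {set multiindex} -> multiindex) : {pred 'rV[int]_3} :=
  fun v => `[< exists w : {set multiindex} -> 'rV[int]_3,
    (forall I, I \in P -> in_block_lattice I (b I) (w I)) /\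
    v = \sum_(I in P) w I >].

Lemma lattice_sum_zmod_closed P b : zmod_closed (lattice_sum P b).
Proof.
split=> [|u v /asboolP[wu [hu ->]] /asboolP[wv [hv ->]]]; apply/asboolP.
  exists (fun=> 0); split=> [I _|]; last by rewrite big1.
  by exists [ffun=> 0]; rewrite big1 // => i _; rewrite ffunE mulr0z.
exists (fun I => wu I - wv I); split=> [I IP|]; last by rewrite sumrB.
have [a ->] := hu I IP; have [c ->] := hv I IP.
exists [ffun k => a k - c k]; rewrite -sumrB; apply: eq_bigr => k _.
by rewrite ffunE mulrzBr.
Qed.

HB.instance Definition _ P b :=
  GRing.isZmodClosed.Build 'rV[int]_3 (lattice_sum P b)
    (lattice_sum_zmod_closed P b).

Definition Z3_quotient (P : {set {set multiindex}})
    (b : {set multiindex} -> multiindex) : zmodType :=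
  Quotient.quot (lattice_sum P b).

(* Main.v *)
Require Import Defs.
From mathcomp Require Import all_boot all_order all_algebra all_field.
From mathcomp Require Import ring_quotient cyclic.
From mathcomp Require Import boolp classical_sets cardinality reals.
Set Implicit Arguments.
Unset Strict Implicit.
Unset Printing Implicit Defensive.
Import GRing.Theory.
Local Open Scope ring_scope.

(** Write chi(v) = x^v1 y^v2 z^v3 for v in Z^3, so that the terms of f at
    (x, y, z) are the p_i chi(i).

    If Z^3 / M is infinite, M does not have full rank, so some nonzero integer
    vector alpha is orthogonal to M ([finite_or_orthogonal]).  Replacing
    (x, y, z) by (x t^alpha1, y t^alpha2, z t^alpha3) multiplies the term of
    index i by t^<i, alpha>, and <i, alpha> is constant on each block I_j
    because differences of elements of I_j lie in M.  So every block sum is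
    multiplied by a power of t and still vanishes ([feval_twist]).

    If Z^3 / M is finite of exponent e, the vectors e delta_k lie in M, and it
    is enough that chi(v)^n = 1 for all v in M.  As chi is multiplicative, this
    is needed only for the generators v = i - i_j of M, where it is Mann's
    theorem ([mann]): in a minimal vanishing rational combination of k roots of
    unity, the ratios of these roots have order dividing the product of the
    primes up to k.

    Mann's theorem is proved by descent.  Let zeta be a primitive N-th root of
    unity, N = p M', and let the combination be V = sum_i a_i zeta^(e_i), with
    e_i divisible by p for at least one i.  As the cyclotomic polynomial is
    irreducible over Q, V still vanishes when zeta is replaced by zeta^h with
    h prime to N ([weighted_sum_conjugate]).  Taking h = 1 + j M' for j < p
    multiplies the i-th term by a power of omega = zeta^M', a primitive p-th
    root of unity, so that a discrete Fourier transform over j isolates the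
    terms with e_i in a fixed class modulo p ([residue_class_filter]).
    When p divides M', every h is prime to N and each class has a zero sum.
    Otherwise a single j0 is exceptional, and the sum over the class s is
    V(j0) / p up to a root of unity; if there are fewer than p terms, some
    class is empty, so V(j0) = 0 and again each class has a zero sum.  By
    minimality, the nonempty class e_i = 0 mod p is everything, and the terms
    are M'-th roots of unity ([prime_dvd_exponents]).  The descent stops when
    N is squarefree with all its prime factors at most k. *)

(** * Galois conjugation of rational relations between roots of unity *)

(** X^n - 1 is the product of the Phi_d for d | n, so z is a root of some Phi_d;
    then z^d = 1, which forces d = n. *)
Lemma root_Cyclotomic (F : numFieldType) (n : nat) (z : F) :
  n.-primitive_root z -> root (map_poly intr 'Phi_n) z.
Proof.
move=> prim_z; have n_gt0 := prim_order_gt0 prim_z.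
have : root (map_poly intr ('X^n - 1 : {poly int})) z.
  rewrite rmorphB rmorph1 /= map_polyXn rootE !hornerE.
  by rewrite (prim_expr_order prim_z) subrr.
rewrite -(prod_Cyclotomic n_gt0) rmorph_prod /= rootE horner_prod prodf_seq_eq0.
case/hasP=> d; rewrite -dvdn_divisors // => d_dv_n /= root_d.
have d_gt0 := dvdn_gt0 n_gt0 d_dv_n.
suff zd1 : z ^+ d = 1.
  suff -> : n = d by [].
  by apply/eqP; rewrite eqn_dvd d_dv_n (prim_order_dvd prim_z) zd1 eqxx.
have : root (map_poly intr ('X^d - 1 : {poly int})) z.
  rewrite -(prod_Cyclotomic d_gt0) rmorph_prod /= rootE horner_prod prodf_seq_eq0.
  by apply/hasP; exists d; rewrite // -dvdn_divisors.
by rewrite rmorphB rmorph1 /= map_polyXn rootE !hornerE subr_eq0 => /eqP.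
Qed.

(** Over Q, Phi_n is the minimal polynomial of an algebraic number w: a factor h
    of it, or its cofactor, vanishes at w and is a multiple of Phi_n. *)
Lemma irreducible_Cyclotomic (n : nat) : (0 < n)%N ->
  irreducible_poly (map_poly intr 'Phi_n : {poly rat}).
Proof.
move=> n_gt0; have [w prim_w] := C_prim_root_exists n_gt0.
have [q [Dq mon_q] min_q] := minCpolyP w.
have -> : map_poly intr 'Phi_n = q :> {poly rat}.
  apply: (map_inj_poly (fmorph_inj (ratr : rat -> algC)) (rmorph0 _)).
  rewrite -Dq (minCpoly_cyclotomic prim_w) -(Cintr_Cyclotomic prim_w).
  by rewrite -map_poly_comp; apply: eq_map_poly => a /=; rewrite ratr_int.
have nz_q := monic_neq0 mon_q.
have root_w : root (map_poly ratr q) w by rewrite min_q.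
split=> [|h nconst_h h_dv_q].
  rewrite -(size_map_poly (ratr : {rmorphism rat -> algC})).
  by apply: root_size_gt1 root_w; rewrite map_poly_eq0.
have nz_h : h != 0 by apply: contraTneq h_dv_q => ->; rewrite dvd0p.
rewrite /eqp h_dv_q /=.
move: root_w; rewrite -(divpK h_dv_q) rmorphM rootM !min_q divpK //.
case/orP=> // /dvdp_leq; rewrite divpN0 // dvdp_leq // => /(_ isT).
rewrite size_divp // leqNgt.
have [h_gt1 q_gt0] : (1 < size h)%N /\ (0 < size q)%N.
  by rewrite size_poly_gt0 nz_q ltn_neqAle eq_sym nconst_h size_poly_gt0 nz_h.
by rewrite ltn_subrL q_gt0 andbT -subn1 subn_gt0 h_gt1.
Qed.

(** Phi_n either divides q or is coprime to it, and the latter is excluded by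
    the common root z; and Phi_n also vanishes at the primitive root z^k. *)
Lemma root_conjugate (F : numFieldType) (n k : nat) (z : F) (q : {poly rat}) :
  n.-primitive_root z -> coprime k n ->
  root (map_poly ratr q) z -> root (map_poly ratr q) (z ^+ k).
Proof.
move=> prim_z co_kn root_z; have n_gt0 := prim_order_gt0 prim_z.
have prim_zk : n.-primitive_root (z ^+ k) by rewrite prim_root_exp_coprime.
pose Phi : {poly rat} := map_poly intr 'Phi_n.
have root_Phi w : n.-primitive_root w -> root (map_poly (ratr : rat -> F) Phi) w.
  move/root_Cyclotomic; rewrite -map_poly_comp; congr (is_true (root _ w)).
  by apply: eq_map_poly => a /=; rewrite ratr_int.
suff Phi_dv_q : Phi %| q.
  by rewrite -(divpK Phi_dv_q) rmorphM rootM root_Phi ?orbT.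
have [_ irr] := irreducible_Cyclotomic n_gt0.
have [gcd1|/irr] := eqVneq (size (gcdp Phi q)) 1; last first.
  by move/(_ (dvdp_gcdl _ _))/eqp_dvdl <-; apply: dvdp_gcdr.
have : coprimep (map_poly (ratr : rat -> F) Phi) (map_poly ratr q).
  by rewrite coprimep_map /coprimep gcd1.
by move/coprimep_root/(_ (root_Phi z prim_z)); rewrite -rootE root_z.
Qed.

(** * Products of primes *)

Definition primorial k := (\prod_(q < k.+1 | prime q) q)%N.

Lemma dvdn_primorial p k : prime p -> (p <= k)%N -> (p %| primorial k)%N.
Proof.
move=> p_pr lepk; have lt : (p < k.+1)%N by [].
by rewrite /primorial (bigD1 (Ordinal lt)) //= dvdn_mulr.
Qed.

(** The dichotomy that drives the descent on N in Mann's theorem: N is squarefree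
    with all its prime factors at most k, or one of its primes p breaks this. *)
Lemma dvdn_primorialVex N k : (0 < N)%N ->
  (N %| primorial k)%N \/
  exists p M, [/\ prime p, N = (p * M)%N & (p %| M)%N || (k < p)%N].
Proof.
move=> N_gt0.
have [/allP all_p|] := boolP (all (fun p : nat => N`_p %| primorial k)%N (primes N)).
  by left; apply/dvdn_partP.
case/allPn=> p; rewrite mem_primes => /and3P[p_pr _ /dvdnP[M]].
rewrite mulnC => defN part_p; right; exists p, M; split=> //.
apply: contraR part_p; rewrite negb_or -leqNgt => /andP[pNM lepk].
suff -> : (N`_p = p)%N by apply: dvdn_primorial.
have M_gt0 : (0 < M)%N by move: N_gt0; rewrite defN muln_gt0 => /andP[].
have logM0 : logn p M = 0 by rewrite lognE p_pr M_gt0 (negPf pNM).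
by rewrite p_part defN lognM ?(prime_gt0 p_pr) // logM0 logn_prime // eqxx expn1.
Qed.

Lemma dvdn_primorial_leq k l : (k <= l)%N -> (primorial k %| primorial l)%N.
Proof.
move=> lekl; rewrite /primorial -!(big_mkord prime id).
by rewrite [X in (_ %| X)%N](big_cat_nat (n := k.+1)) ?ltnS // dvdn_mulr.
Qed.

(** * Mann's theorem *)

Section Mann.
Variables (F : numFieldType) (T : finType) (a : T -> rat).
Implicit Types (I J : {set T}) (u : T -> F).

Definition weighted_sum u J : F := \sum_(i in J) ratr (a i) * u i.

Definition vanishes_minimally u I : Prop :=
  weighted_sum u I = 0 /\
  forall J, J != finset.set0 -> J \proper I -> weighted_sum u J != 0.

Lemma weighted_sum_conjugate (n k : nat) (z : F) (e : T -> nat) I :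
  n.-primitive_root z -> coprime k n ->
  weighted_sum (fun i => z ^+ e i) I = 0 ->
  weighted_sum (fun i => z ^+ (e i * k)) I = 0.
Proof.
move=> prim_z co_kn sum0; pose q := \sum_(i in I) a i *: 'X^(e i) : {poly rat}.
have evalq w : (map_poly ratr q).[w] = weighted_sum (fun i => w ^+ e i) I.
  rewrite rmorph_sum horner_sum; apply: eq_bigr => i _ /=.
  by rewrite map_polyZ map_polyXn !hornerE.
have := root_conjugate (q := q) prim_z co_kn; rewrite !rootE !evalq sum0 eqxx.
move/(_ isT)/eqP; apply: etrans; apply: eq_bigr => i _.
by rewrite mulnC exprM.
Qed.

Lemma sum_powers_root1 (n : nat) (w : F) : w ^+ n = 1 ->
  \sum_(j < n) w ^+ j = if w == 1 then n%:R else 0.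
Proof.
move=> wn1; have [->|nt_w] := eqVneq w 1.
  by under eq_bigr do rewrite expr1n; rewrite sumr_const card_ord.
apply/eqP; have /eqP := subrX1 w n.
by rewrite wn1 subrr eq_sym mulf_eq0 subr_eq0 (negPf nt_w).
Qed.

Definition residue_class (p : nat) (e : T -> nat) I (s : nat) : {set T} :=
  [set i in I | e i == s %[mod p]].

(** With w = z^M, the term of index i on the left is a_i z^(e i) times the sum
    over j of (w^(e i) / w^s)^j, which is p or 0 according to whether
    e i = s mod p. *)
Lemma residue_class_filter (p M s : nat) (z : F) (e : T -> nat) I :
  (0 < p)%N -> (p * M).-primitive_root z ->
  \sum_(j < p) z ^- (M * s * j) *
     weighted_sum (fun i => z ^+ (e i * (1 + j * M))) I
  = p%:R * weighted_sum (fun i => z ^+ e i) (residue_class p e I s).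
Proof.
move=> p_gt0 prim_z; have z0 : z != 0.
  by rewrite (prim_root_eq0 prim_z) -lt0n (prim_order_gt0 prim_z).
have prim_w : p.-primitive_root (z ^+ M).
  have := dvdn_prim_root prim_z (dvdn_mulr M (dvdnn p)).
  by rewrite mulKn.
rewrite big_distrr /=.
under eq_bigr do rewrite big_distrr /=.
rewrite exchange_big /=.
rewrite [RHS](eq_bigl (fun i => (i \in I) && (e i == s %[mod p]))); last first.
  by move=> i; rewrite inE.
rewrite [RHS]big_mkcondr /=; apply: eq_bigr => i _.
pose c := (z ^+ M) ^+ e i / (z ^+ M) ^+ s.
transitivity (\sum_(j < p) (ratr (a i) * z ^+ e i) * c ^+ j).
  apply: eq_bigr => j _.
  rewrite mulnDr muln1 exprD /c expr_div_n -!exprM.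
  by rewrite [(e i * _)%N]mulnCA [(j * _)%N]mulnC (mulnC (e i)) mulrC !mulrA.
have z_unit k : z ^+ k != 0 by rewrite expf_neq0.
have c1 : (c == 1) = (e i == s %[mod p]).
  rewrite -(eq_prim_root_expr prim_w) -subr_eq0 -{1}(divff (z_unit (M * s)%N)).
  rewrite /c -!exprM -mulrBl mulf_eq0 subr_eq0 invr_eq0.
  by rewrite (negPf (z_unit _)) orbF.
rewrite -big_distrr /= sum_powers_root1 ?c1.
  by case: ifP => _; rewrite ?mulr0 // mulrC.
by rewrite expr_div_n -!exprM ![(M * _ * p)%N]mulnAC (mulnC M)
   !(exprM z (p * M)) (prim_expr_order prim_z) !expr1n divr1.
Qed.

Lemma empty_residue_class (p : nat) (e : T -> nat) I :
  (#|I| < p)%N -> exists s, residue_class p e I s = finset.set0.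
Proof.
move=> ltIp; have p_gt0 : (0 < p)%N by apply: leq_ltn_trans ltIp.
pose r i : 'I_p := Ordinal (ltn_pmod (e i) p_gt0).
have : [set: 'I_p] :\: (r @: I) != finset.set0.
  rewrite -card_gt0 cardsD finset.setTI cardsT card_ord subn_gt0.
  exact: leq_ltn_trans (leq_imset_card _ _) ltIp.
case/finset.set0Pn=> s; rewrite inE => /andP[sNr _]; exists s; apply/finset.setP => i.
rewrite !inE; apply/negP => /andP[iI /eqP ei_s]; case/negP: sNr.
apply/imsetP; exists i => //; apply: val_inj => /=.
by rewrite ei_s modn_small.
Qed.

(** The descent step.  The hypothesis on i0 makes the class of 0 modulo p
    nonempty, so that by minimality this class can only have a zero sum if it
    is all of I. *)
Lemma prime_dvd_exponents (p M : nat) (z : F) (e : T -> nat) I i0 :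
  prime p -> (p * M).-primitive_root z ->
  vanishes_minimally (fun i => z ^+ e i) I ->
  i0 \in I -> (p %| e i0)%N -> (p %| M)%N || (#|I| < p)%N ->
  forall i, i \in I -> (p %| e i)%N.
Proof.
move=> p_pr prim_z [sum0 minI] i0I p_dv_e0 hyp; have p_gt0 := prime_gt0 p_pr.
have z0 : z != 0.
  by rewrite (prim_root_eq0 prim_z) -lt0n (prim_order_gt0 prim_z).
pose S s := weighted_sum (fun i => z ^+ e i) (residue_class p e I s).
pose V j := weighted_sum (fun i => z ^+ (e i * (1 + j * M))) I.
have SE s : p%:R * S s = \sum_(j < p) z ^- (M * s * j) * V j.
  by rewrite residue_class_filter.
(* 1 + j M is always prime to M, so only p can obstruct the conjugation. *)
have V0 j : ~~ (p %| 1 + j * M)%N -> V j = 0.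
  move=> pNj; apply: (weighted_sum_conjugate prim_z) => //.
  rewrite coprimeMr coprime_sym prime_coprime // pNj /=.
  by rewrite coprime_sym /coprime addnC gcdnMDl gcdn1.
suff S0 : S 0 = 0.
  suff -> : I = residue_class p e I 0 by move=> i; rewrite !inE mod0n => /andP[].
  have subI : residue_class p e I 0 \subset I by apply/fintype.subsetP => i /setIdP[].
  apply/eqP; rewrite finset.eqEsubset subI andbT; apply/negPn/negP => NsubI.
  have : residue_class p e I 0 \proper I by rewrite properE subI.
  move/(minI _ _); rewrite -/(S 0%N) S0 eqxx => /(_ _)/negP; case=> //.
  by apply/finset.set0Pn; exists i0; rewrite !inE i0I mod0n.
suff pS0 : p%:R * S 0 = 0.
  by move/eqP: pS0; rewrite mulf_eq0 Num.Theory.pnatr_eq0 -leqn0 leqNgt p_gt0 => /eqP.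
case: (pickP (fun j : 'I_p => p %| 1 + j * M)%N) => [j0 p_dv_j0 | good]; last first.
  by rewrite SE big1 // => j _; rewrite V0 ?mulr0 // good.
have pNM : ~~ (p %| M)%N.
  apply: contraL p_dv_j0 => p_dv_M.
  by rewrite dvdn_addl ?dvdn_mull // dvdn1 neq_ltn prime_gt1 ?orbT.
(* M is invertible modulo p, so j0 is the only index with p | 1 + j M. *)
have SE0 s : p%:R * S s = z ^- (M * s * j0) * V j0.
  rewrite SE (bigD1 j0) //= big1 ?addr0 // => j nj; rewrite V0 ?mulr0 //.
  apply: contra nj => p_dv_j; apply/eqP/val_inj => /=.
  have : 1 + j * M == 1 + j0 * M %[mod p] by rewrite (eqP p_dv_j) (eqP p_dv_j0).
  rewrite eqn_modDl.
  have := ltn_ord j; have := ltn_ord j0.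
  wlog le : j j0 {p_dv_j p_dv_j0} / (j <= j0)%N => [W l1 l2 h|].
    case/orP: (leq_total j j0) => le; first exact: W.
    by symmetry; apply: W; rewrite // eq_sym.
  move=> l1 l2; rewrite eq_sym eqn_mod_dvd ?leq_mul2r ?le ?orbT // -mulnBl.
  rewrite Gauss_dvdl ?prime_coprime // => /dvdn_leq.
  rewrite subn_gt0 => h; apply/eqP; rewrite eqn_leq le leqNgt; apply/negP => /h.
  by rewrite leqNgt (leq_ltn_trans (leq_subr _ _)).
rewrite (negPf pNM) in hyp.
have [s Ss0] := empty_residue_class e hyp.
have : p%:R * S s = 0 by rewrite /S Ss0 /weighted_sum big_set0 mulr0.
rewrite !SE0 => /eqP; rewrite mulf_eq0 invr_eq0 expf_eq0 (negPf z0) andbF => /eqP ->.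
by rewrite mulr0.
Qed.

(** The normalisation u i0 = 1 turns the ratios u i / u i0 into the values u i,
    and it survives the descent from N to N / p. *)
Theorem mann (N : nat) (z : F) u I i0 :
  N.-primitive_root z -> vanishes_minimally u I ->
  (forall i, i \in I -> u i ^+ N = 1) -> i0 \in I -> u i0 = 1 ->
  forall i, i \in I -> u i ^+ primorial #|I| = 1.
Proof.
elim/ltn_ind: N z => N IHN z prim_z minI uN i0I u01.
have N_gt0 := prim_order_gt0 prim_z.
have [N_dv|[p [M [p_pr defN hyp]]]] := dvdn_primorialVex #|I| N_gt0.
  by move=> i iI; case/dvdnP: N_dv => q ->; rewrite mulnC exprM uN // expr1n.
have M_gt0 : (0 < M)%N by move: N_gt0; rewrite defN muln_gt0 => /andP[].
have prim_zp : M.-primitive_root (z ^+ p).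
  have := dvdn_prim_root prim_z (_ : M %| N)%N.
  by rewrite defN mulnK // dvdn_mull // => /(_ isT).
apply: (IHN M _ _ prim_zp minI _ i0I u01); first by rewrite defN ltn_Pmull ?prime_gt1.
(* e i is the discrete logarithm of u i to the base z when i is in I. *)
pose e i : nat := if [pick k : 'I_N | u i == z ^+ k] is Some k then k else 0.
have uE i : i \in I -> u i = z ^+ e i.
  move=> iI; rewrite /e; case: pickP => [k /eqP //|no_k].
  by have [k uk] := prim_rootP prim_z (uN i iI); have := no_k k; rewrite -uk eqxx.
have sumE J : J \subset I -> weighted_sum u J = weighted_sum (fun i => z ^+ e i) J.
  by move=> /fintype.subsetP JI; apply: eq_bigr => i /JI iI; rewrite -uE.
have p_dv_e0 : (p %| e i0)%N.
  have p_dv_N : (p %| N)%N by rewrite defN dvdn_mulr.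
  apply: dvdn_trans p_dv_N _.
  by rewrite (prim_order_dvd prim_z) -uE ?u01.
have minE : vanishes_minimally (fun i => z ^+ e i) I.
  case: minI => sum0 minI; split=> [|J J0 ltJ]; rewrite -sumE ?sum0 //.
    exact: minI.
  exact: proper_sub.
rewrite defN in prim_z.
move=> i iI; rewrite uE // -exprM; apply/eqP; rewrite -(prim_order_dvd prim_z).
by rewrite dvdn_mul // (prime_dvd_exponents p_pr prim_z minE i0I).
Qed.
End Mann.

Lemma vanishes_minimally_scale (F : numFieldType) (T : finType)
    (a : T -> rat) (u : T -> F) (c : F) I :
  c != 0 -> vanishes_minimally a u I ->
  vanishes_minimally a (fun i => u i * c) I.
Proof.
move=> c0 [sum0 minI].
have sumE J : weighted_sum a (fun i => u i * c) J = weighted_sum a u J * c.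
  by rewrite /weighted_sum big_distrl; apply: eq_bigr => i _; rewrite mulrA.
split=> [|J J0 ltJ]; rewrite sumE ?sum0 ?mul0r // mulf_neq0 //; exact: minI.
Qed.

(** In characteristic zero X^n - 1 is separable, so it has n distinct roots in
    F, and they form a cyclic group. *)
Lemma closed_prim_root (F : numClosedFieldType) n :
  (0 < n)%N -> exists z : F, n.-primitive_root z.
Proof.
move=> n_gt0; have [s Ds] := closed_field_poly_normal ('X^n - 1 : {poly F}).
move: Ds; rewrite lead_coefXnsubC // scale1r => Ds.
suff /hasP[z _ prim_z] : has n.-primitive_root s by exists z.
apply: has_prim_root => //.
- by apply/allP=> z; rewrite /root_of_unity Ds root_prod_XsubC.
- by rewrite -separable_prod_XsubC -Ds separable_Xn_sub_1 // Num.Theory.pnatr_eq0 -lt0n.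
- by rewrite -ltnS -(size_prod_XsubC s id) -Ds size_XnsubC.
Qed.

Lemma root1_neq0 (F : fieldType) (w : F) N : (0 < N)%N -> w ^+ N = 1 -> w != 0.
Proof.
move=> N_gt0 wN; suff : w ^+ N != 0 by rewrite expf_eq0 N_gt0.
by rewrite wN oner_neq0.
Qed.

(** * Integer vectors: full rank or a common orthogonal vector *)

Lemma common_denominator (T : finType) (f : T -> rat) :
  exists2 d : nat, (0 < d)%N &
    exists c : T -> int, forall t, (c t)%:~R = d%:R * f t.
Proof.
pose D := \prod_t denq (f t).
have D_gt0 : 0 < D by apply: Num.Theory.prodr_gt0 => t _; apply: denq_gt0.
exists `|D|%N; first by rewrite absz_gt0 Num.Theory.lt0r_neq0.
exists (fun t => numq (f t) * \prod_(s | s != t) denq (f s)) => t.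
rewrite pmulrn gtz0_abs // /D [X in X%:~R * _](bigD1 t) //= !intrM numqE.
by rewrite [RHS]mulrC mulrA.
Qed.

(** Linear algebra over Q for the matrix A whose rows are the vectors g k: either
    A has a left inverse, or its right kernel is nonzero.  Clearing denominators
    makes the witness integral in both cases. *)
Lemma spans_or_annihilated (K : finType) (n : nat) (g : K -> 'rV[int]_n) :
  (exists2 d : nat, (0 < d)%N &
     forall v, exists c : K -> int, v *+ d = \sum_k g k *~ c k) \/
  (exists2 a : 'cV[int]_n, a != 0 & forall k, g k *m a = 0).
Proof.
pose A : 'M[rat]_(#|K|, n) := \matrix_(k, j) (g (enum_val k) 0 j)%:~R.
have [/row_fullP[B BA]|] := boolP (row_full A).
  have [d d_gt0 [c dB]] := common_denominator (fun ij => B ij.1 ij.2).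
  left; exists d => // v.
  exists (fun k => \sum_i v 0 i * c (i, enum_rank k)).
  apply/rowP => j; apply: (@intr_inj rat).
  transitivity (d%:R * \sum_i (v 0 i)%:~R * (B *m A) i j).
    rewrite BA (bigD1 j) //= big1 => [|i nij].
      by rewrite mxE eqxx mulr1 addr0 mulmxnE rmorphMn mulr_natl.
    by rewrite mxE (negPf nij) mulr0.
  rewrite summxE rmorph_sum (reindex _ (onW_bij _ (enum_val_bij K))) /=.
  transitivity (\sum_i \sum_l (v 0 i)%:~R * (d%:R * B i l) * A l j).
    rewrite big_distrr; apply: eq_bigr => i _ /=; rewrite mxE !big_distrr.
    by apply: eq_bigr => l _ /=; rewrite mulrCA !mulrA.
  rewrite exchange_big; apply: eq_bigr => l _ /=.
  rewrite -scaler_int intz [in RHS]mxE rmorphM rmorph_sum big_distrl /=.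
  apply: eq_bigr => i _; rewrite rmorphM enum_valK /= mxE.
  by rewrite -(dB (i, l)).
rewrite -cokermx_eq0 => /matrix0Pn[i0 [j0 nz]].
have [d d_gt0 [c dB]] := common_denominator (fun i => cokermx A i j0).
right; exists (\col_i c i) => [|k].
  apply/matrix0Pn; exists i0, 0; rewrite mxE -(intr_eq0 rat) dB.
  by rewrite mulf_neq0 // Num.Theory.pnatr_eq0 -lt0n.
apply/matrixP => i j; rewrite !ord1; apply: (@intr_inj rat).
transitivity (d%:R * (A *m cokermx A) (enum_rank k) j0); last first.
  by rewrite mulmx_coker !mxE mulr0.
rewrite !mxE rmorph_sum big_distrr; apply: eq_bigr => l _ /=.
by rewrite [X in _ = _ * (X * _)]mxE enum_rankK mxE rmorphM /= dB mulrCA.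
Qed.

(** * The lattice M and the quotient Z^3 / M *)

Lemma lattice_sum_ind (P : {set {set multiindex}})
    (b : {set multiindex} -> multiindex) (Q : 'rV[int]_3 -> Prop) :
  Q 0 -> (forall u v, Q u -> Q v -> Q (u - v)) ->
  (forall I i, I \in P -> i \in I -> Q (to_Z3 i - to_Z3 (b I))) ->
  forall v, v \in lattice_sum P b -> Q v.
Proof.
move=> Q0 QB Qgen; have QN u : Q u -> Q (- u) by rewrite -sub0r; apply: QB.
have QD u v : Q u -> Q v -> Q (u + v) by rewrite -[v in u + v]opprK => ? /QN; apply: QB.
have QMz u (k : int) : Q u -> Q (u *~ k).
  move=> Qu; have Qn n : Q (u *+ n).
    by elim: n => [|n IHn]; rewrite ?mulr0n // mulrS; apply: QD.
  by case: k => n; rewrite ?NegzE ?mulrNz -pmulrn; [|apply: QN]; apply: Qn.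
move=> v /asboolP[w [w_in ->]]; elim/big_ind: _ => // I IP.
have [c ->] := w_in I IP; elim/big_ind: _ => // k _; apply: QMz.
pose gens := [tuple of [seq to_Z3 i - to_Z3 (b I) | i in I]].
rewrite -tnth_nth; case/mapP: (mem_tnth k gens).
by move=> i; rewrite mem_enum => iI ->; apply: Qgen.
Qed.

Lemma lattice_sum_gen (P : {set {set multiindex}})
    (b : {set multiindex} -> multiindex) I i :
  I \in P -> i \in I -> to_Z3 i - to_Z3 (b I) \in lattice_sum P b.
Proof.
move=> IP iI; apply/asboolP.
(* Only the block I contributes, with coefficient 1 on the generator i. *)
exists (fun J => if J == I then to_Z3 i - to_Z3 (b I) else 0); split=> [J _|].
  case: eqP => [->|_]; last first.
    by exists [ffun=> 0]; rewrite big1 // => k _; rewrite ffunE mulr0z.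
  pose s := [tuple of [seq to_Z3 i - to_Z3 (b I) | i in I]].
  have : to_Z3 i - to_Z3 (b I) \in s.
    by apply/mapP; exists i; rewrite ?mem_enum.
  case/tnthP=> k ->; exists [ffun l => (l == k)%:Z].
  rewrite (bigD1 k) //= big1 => [|l nlk]; rewrite ffunE ?eqxx ?(negPf nlk) ?mulr0z //.
  by rewrite addr0 mulr1z (tnth_nth 0).
rewrite -big_mkcondr (big_pred1 I) // => J.
by apply/andP/eqP => [[_ /eqP]|->].
Qed.

Lemma pi_lattice_eq0 P b (v : 'rV[int]_3) :
  (\pi_(Quotient.quot (lattice_sum P b))%qT v == 0) = (v \in lattice_sum P b).
Proof. by rewrite -[v in RHS]subr0 Quotient.idealrBE raddf0. Qed.

Lemma exponent_lattice P b e (v : 'rV[int]_3) :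
  is_exponent (Z3_quotient P b) e -> v *+ e \in lattice_sum P b.
Proof.
by case=> _ killed _; rewrite -pi_lattice_eq0 raddfMn /= killed.
Qed.

(** Every class has a representative with coordinates in [0, d), found by
    reducing the coordinates modulo d. *)
Lemma finite_quotient P b (d : nat) : (0 < d)%N ->
  (forall v, v *+ d \in lattice_sum P b) ->
  finite_set [set: Z3_quotient P b]%classic.
Proof.
case: d => // d _ dM.
pose f (h : {ffun 'I_3 -> 'I_d.+1}) : Z3_quotient P b :=
  \pi_(Quotient.quot (lattice_sum P b))%qT (\row_k (h k : nat)%:Z).
apply: sub_finite_set (finite_image f (finite_finset (X := setT))) => q _.
pose v : 'rV[int]_3 := repr (q : Quotient.quot (lattice_sum P b)).
have lt_mod (k : 'I_3) : (`|(v 0%R k %% d.+1)%Z| < d.+1)%N.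
  by rewrite -ltz_nat gez0_abs ?modz_ge0 // ltz_pmod.
exists [ffun k => Ordinal (lt_mod k)] => //.
rewrite /f -[q in RHS](reprK (q : Quotient.quot (lattice_sum P b))) -/v.
apply/eqP; rewrite eq_sym -Quotient.idealrBE.
suff -> : v - \row_k ([ffun k => Ordinal (lt_mod k)] k : nat)%:Z
   = (\row_k (v 0%R k %/ d.+1)%Z) *+ d.+1 by apply: dM.
apply/rowP => k; rewrite !mxE mulmxnE mxE ffunE /= gez0_abs ?modz_ge0 //.
by rewrite {1}(divz_eq (v 0 k) d.+1) addrK -mulr_natr natz.
Qed.

(** The block of i is found as [pblock P i], so that the generators of all the
    M_j form a single family indexed by i. *)
Lemma finite_or_orthogonal P b :
  finset.partition P [set: multiindex] ->
  finite_set [set: Z3_quotient P b]%classic \/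
  exists2 a : 'cV[int]_3, a != 0 &
    forall i, (to_Z3 i - to_Z3 (b (finset.pblock P i))) *m a = 0.
Proof.
move=> partP.
case: (spans_or_annihilated (fun i => to_Z3 i - to_Z3 (b (finset.pblock P i)))).
  case=> d d_gt0 span; left; apply: finite_quotient d_gt0 _ => v.
  have [c ->] := span v; apply: rpred_sum => i _; apply: rpredMz.
  have iP : i \in finset.cover P by rewrite (cover_partition partP) inE.
  by apply: lattice_sum_gen; rewrite ?pblock_mem ?mem_pblock.
by right.
Qed.

(** * Evaluating monomials on the lattice *)

Section Monomials.
Variable F : numClosedFieldType.
Implicit Types (x y z t : F) (v : 'rV[int]_3).

Definition monomial x y z v : F := x ^ v 0 0 * y ^ v 0 1 * z ^ v 0 2.

Lemma monomial_Z3 x y z (i : multiindex) :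
  monomial x y z (to_Z3 i) = x ^+ i 0 * y ^+ i 1 * z ^+ i 2.
Proof. by rewrite /monomial !mxE. Qed.

Lemma partial_sumE p x y z J :
  partial_sum p x y z J = weighted_sum p (fun i => monomial x y z (to_Z3 i)) J.
Proof. by apply: eq_bigr => i _; rewrite monomial_Z3 !mulrA. Qed.

Lemma monomialB x y z u v : x != 0 -> y != 0 -> z != 0 ->
  monomial x y z (u - v) = monomial x y z u / monomial x y z v.
Proof.
move=> x0 y0 z0; rewrite /monomial !mxE !expfzDr // -!invr_expz !invfM.
by rewrite [RHS]mulrACA [X in _ = X * _]mulrACA.
Qed.

Lemma monomial_neq0 x y z v :
  x != 0 -> y != 0 -> z != 0 -> monomial x y z v != 0.
Proof. by move=> x0 y0 z0; rewrite !mulf_neq0 ?expfz_neq0. Qed.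

Lemma monomial_expr_root1 x y z v N :
  x ^+ N = 1 -> y ^+ N = 1 -> z ^+ N = 1 -> monomial x y z v ^+ N = 1.
Proof.
have root1 w (k : int) : w ^+ N = 1 -> (w ^ k) ^+ N = 1.
  by move=> wN; rewrite exprnP exprz_exp mulrC -exprz_exp -exprnP wN exp1rz.
by move=> xN yN zN; rewrite !exprMn !root1 // !mulr1.
Qed.

(** This is where the one-parameter family comes from: the twist acts on the
    monomial of exponent v through the pairing of v with a only. *)
Lemma monomial_twist x y z t (a : 'cV[int]_3) v :
  t != 0 ->
  monomial (x * t ^ a 0 0) (y * t ^ a 1 0) (z * t ^ a 2 0) v =
  monomial x y z v * t ^ (v *m a) 0 0.
Proof.
move=> t0; rewrite /monomial !expfzMl !exprz_exp mxE !big_ord_recl big_ord0 addr0.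
rewrite !expfzDr // !(mulrC (v 0 _)).
have -> : lift ord0 ord0 = 1 :> 'I_3 by apply: val_inj.
have -> : lift ord0 (lift ord0 ord0) = 2 :> 'I_3 by apply: val_inj.
by rewrite [X in X * _ = _]mulrACA [LHS]mulrACA !mulrA.
Qed.

(** Mann's theorem for one block, after division of its terms by the monomial of
    the base point. *)
Lemma block_ratio_expr p x y z N I i0 :
  (0 < N)%N -> x ^+ N = 1 -> y ^+ N = 1 -> z ^+ N = 1 ->
  minimal_vanishing p x y z I -> i0 \in I ->
  forall i, i \in I ->
    monomial x y z (to_Z3 i - to_Z3 i0) ^+ primorial #|I| = 1.
Proof.
move=> N_gt0 xN yN zN [sum0 minI] i0I.
have [[x0 y0] z0] :=
  (root1_neq0 N_gt0 xN, root1_neq0 N_gt0 yN, root1_neq0 N_gt0 zN).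
have [w prim_w] := closed_prim_root F N_gt0.
pose u i := monomial x y z (to_Z3 i - to_Z3 i0).
have uN i : i \in I -> u i ^+ N = 1 by move=> _; apply: monomial_expr_root1.
have u1 : u i0 = 1 by rewrite /u monomialB // divff // monomial_neq0.
apply: (mann (a := p) prim_w _ uN i0I u1); rewrite /u.
have -> : (fun i => monomial x y z (to_Z3 i - to_Z3 i0)) =
    (fun i => monomial x y z (to_Z3 i) / monomial x y z (to_Z3 i0)).
  by apply: funext => i; rewrite monomialB.
apply: vanishes_minimally_scale; first by rewrite invr_eq0 monomial_neq0.
by split=> [|J J0 ltJ]; rewrite -partial_sumE // minI.
Qed.

Lemma lattice_monomial_expr p x y z N (P : {set {set multiindex}}) b :
  (0 < N)%N -> x ^+ N = 1 -> y ^+ N = 1 -> z ^+ N = 1 ->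
  (forall I, I \in P -> minimal_vanishing p x y z I) ->
  (forall I, I \in P -> b I \in I) ->
  forall v, v \in lattice_sum P b ->
    monomial x y z v ^+ primorial (\max_(I in P) #|I|) = 1.
Proof.
move=> N_gt0 xN yN zN minP bP.
have [[x0 y0] z0] :=
  (root1_neq0 N_gt0 xN, root1_neq0 N_gt0 yN, root1_neq0 N_gt0 zN).
apply: lattice_sum_ind => [|u v Qu Qv|I i IP iI].
- by rewrite -[0](subrr 0) monomialB // divff ?expr1n // monomial_neq0.
- by rewrite monomialB // expr_div_n Qu Qv divr1.
have leI : (#|I| <= \max_(J in P) #|J|)%N by apply: leq_bigmax_cond.
have /dvdnP[q ->] := dvdn_primorial_leq leI.
rewrite mulnC exprM (block_ratio_expr N_gt0 xN yN zN (minP I IP) (bP I IP) iI).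
by rewrite expr1n.
Qed.

(** e times a basis vector lies in M, and its monomial is the e-th power of the
    corresponding coordinate. *)
Lemma coordinate_orders p x y z N (P : {set {set multiindex}}) b e :
  (0 < N)%N -> x ^+ N = 1 -> y ^+ N = 1 -> z ^+ N = 1 ->
  (forall I, I \in P -> minimal_vanishing p x y z I) ->
  (forall I, I \in P -> b I \in I) ->
  is_exponent (Z3_quotient P b) e ->
  let n := primorial (\max_(I in P) #|I|) in
  [/\ x ^+ (e * n) = 1, y ^+ (e * n) = 1 & z ^+ (e * n) = 1].
Proof.
move=> N_gt0 xN yN zN minP bP exp_e n.
have mono (k : 'I_3) : monomial x y z (delta_mx 0 k *+ e) ^+ n = 1.
  exact: (lattice_monomial_expr N_gt0 xN yN zN minP bP (exponent_lattice _ exp_e)).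
split; rewrite exprM.
- by have := mono 0; rewrite /monomial !mulmxnE !mxE /= mul0rn
    !expr0z !mulr1 !natz -exprnP.
- by have := mono 1; rewrite /monomial !mulmxnE !mxE /= mul0rn
    !expr0z mul1r mulr1 !natz -exprnP.
- by have := mono 2; rewrite /monomial !mulmxnE !mxE /= mul0rn
    !expr0z !mul1r !natz -exprnP.
Qed.

Lemma feval_twist p x y z t (P : {set {set multiindex}}) b (a : 'cV[int]_3) :
  finset.partition P [set: multiindex] ->
  (forall I, I \in P -> partial_sum p x y z I = 0) ->
  (forall i, (to_Z3 i - to_Z3 (b (finset.pblock P i))) *m a = 0) -> t != 0 ->
  feval p (x * t ^ a 0 0) (y * t ^ a 1 0) (z * t ^ a 2 0) = 0.
Proof.
move=> partP P0 orth t0; rewrite /feval partial_sumE /weighted_sum.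
rewrite (set_partition_big _ partP) big1 //= => I IP.
transitivity (partial_sum p x y z I * t ^ (to_Z3 (b I) *m a) 0 0); last first.
  by rewrite P0 // mul0r.
rewrite partial_sumE big_distrl; apply: eq_bigr => i iI /=.
rewrite monomial_twist // mulrA; congr (_ * t ^ (_ : 'M[int]_1) 0 0).
have /and3P[_ trivP _] := partP.
apply/eqP; rewrite -subr_eq0 -mulmxBl -(def_pblock trivP IP iI).
by rewrite orth.
Qed.
End Monomials.

Theorem proposition2p2 (R : realType) (p : multiindex -> rat) (x y z : R[i])
    (hx : is_root_of_unity x) (hy : is_root_of_unity y)
    (hz : is_root_of_unity z)
    (hf : feval p x y z = 0)
    (P : {set {set multiindex}})
    (hP : finset.partition P [set: multiindex])
    (hmin : forall I : {set multiindex}, I \in P -> minimal_vanishing p x y z I)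
    (b : {set multiindex} -> multiindex)
    (hb : forall I : {set multiindex}, I \in P -> b I \in I) :
  (~ finite_set [set: Z3_quotient P b]%classic ->
     exists a1 a2 a3 : int,
       ~ (a1 = 0 /\ a2 = 0 /\ a3 = 0) /\
       forall t : R[i], t != 0 ->
         feval p (x * t ^ a1) (y * t ^ a2) (z * t ^ a3) = 0)
  /\
  (finite_set [set: Z3_quotient P b]%classic ->
     forall e m : nat,
       is_exponent (Z3_quotient P b) e ->
       is_common_order x y z m ->
       (m %| e * \prod_(q < (\max_(I in P) #|I|).+1 | prime q) q)%N).
Proof.
split=> [infQ | _ e m exp_e [k1 [k2 [k3 [prim_x prim_y prim_z ->]]]]].
  case: (finite_or_orthogonal b hP) => [/infQ // | [a a_neq0 orth]].
  exists (a 0 0), (a 1 0), (a 2 0); split=> [[a0 [a1 a2]] | t t_neq0].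
    case/negP: a_neq0; apply/eqP/matrixP => i j; rewrite ord1 mxE.
    case: i => [[|[|[|//]]] lti]; [rewrite -a0 | rewrite -a1 | rewrite -a2];
      by congr (a _ 0); apply: val_inj.
  by apply: feval_twist hP _ orth t_neq0 => I /hmin[].
have [[k1_gt0 k2_gt0] k3_gt0] :=
  (prim_order_gt0 prim_x, prim_order_gt0 prim_y, prim_order_gt0 prim_z).
(* Any common multiple of the three orders will do to place x, y, z among the
   powers of one root of unity. *)
pose N := (k1 * k2 * k3)%N.
have N_gt0 : (0 < N)%N by rewrite !muln_gt0 k1_gt0 k2_gt0.
have xN : x ^+ N = 1.
  by rewrite /N -mulnA exprM (prim_expr_order prim_x) expr1n.
have yN : y ^+ N = 1.
  by rewrite /N mulnAC mulnC exprM (prim_expr_order prim_y) expr1n.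
have zN : z ^+ N = 1.
  by rewrite /N mulnC exprM (prim_expr_order prim_z) expr1n.
have [xen yen zen] := coordinate_orders N_gt0 xN yN zN hmin hb exp_e.
rewrite -/(primorial _) !dvdn_lcm.
rewrite (prim_order_dvd prim_x) (prim_order_dvd prim_y) (prim_order_dvd prim_z).
by rewrite xen yen zen eqxx.
Qed.
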